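(* Consider a panel with $i=1,\dots,N$ and $t=1,\dots,T$ generated by $$Y_{it}=X_{it}'\beta^0+\Gamma_{it}+\varepsilon_{it},$$ where $X_{it}=(X_{it,1},\dots,X_{it,K})'\in\mathbb{R}^K$ is observed, $\beta^0\in\mathbb{R}^K$ is the true parameter, and the $N\times T$ matrices $\Gamma=(\Gamma_{it})$ and $\varepsilon=(\varepsilon_{it})$ are unobserved (arbitrary dependence between $X$ and $\Gamma$ is allowed). Let $R_{NT}$ be a sequence of positive integers and let $\widehat\beta_{\rm LS}$ be the least-squares interactive fixed effects estimator computed with $R=R_{NT}$ factors. Suppose the following hold as $N,T\to\infty$: (1) $\frac1{NT}\sum_{i=1}^N\sum_{t=1}^T X_{it,k}^2=O_P(1)$ for $k=1,\dots,K$, and $\|\varepsilon\|=O_P(\sqrt{\max\{N,T\}})$; (2) $\sum_{i=1}^N\sum_{t=1}^T X_{it,k}\varepsilon_{it}=O_P(\sqrt{NT})$ for $k=1,\dots,K$; (3) there is a constant $b>0$ such that, with probability approaching one, $$\min_{\delta\in\mathbb{R}^K,\ \|\delta\|=1}\ \sum_{r=2R_{NT}+1}^{\min(N,T)}\sigma_r^2\!\left[\frac{\delta\cdot X}{\sqrt{NT}}\right]\ \ge\ b,$$ where $\delta\cdot X=\sum_{k=1}^K\delta_kX_k$; (4) there is a constant $\rho>3/2$ such that $\frac1{NT}\sum_{r=R_{NT}+1}^{\min(N,T)}\sigma_r^2(\Gamma)=O_P(R_{NT}^{1-2\rho})$. Assume moreover that $R_{NT}=o(\min\{N,T\})$. Then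 $$\widehat\beta_{\rm LS}-\beta^0=O_P\big(R_{NT}^{(3-2\rho)/2}\big)+O_P\big(R_{NT}(\min\{N,T\})^{-1/2}\big).$$ Consequently, choosing $R_{NT}\propto(\min\{N,T\})^{1/(2\rho-1)}$ gives $$\widehat\beta_{\rm LS}-\beta^0=O_P\Big(\min\{N,T\}^{\frac{3-2\rho}{2(2\rho-1)}}\Big).$$
   Context: $X_k$ denotes the $N\times T$ matrix $(X_{it,k})$. For a matrix $A$, $\sigma_r(A)$ is its $r$-th largest singular value and $\|A\|$ its spectral norm; $\|\delta\|$ is the Euclidean norm of a vector. The least-squares interactive fixed effects estimator with $R$ factors is $$\widehat\beta_{\rm LS}\in\operatorname*{argmin}_{\beta\in\mathbb{R}^K}\ \min_{\lambda\in\mathbb{R}^{N\times R},\,f\in\mathbb{R}^{T\times R}}\ \sum_{i=1}^N\sum_{t=1}^T\Big(Y_{it}-X_{it}'\beta-\sum_{r=1}^R\lambda_{ir}f_{tr}\Big)^2.$$ ''With probability approaching one'' (wpa1) means with probability tending to one as $N,T\to\infty$. *)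

(* Defs.v *)
From HB Require Import structures.
From mathcomp Require Import all_boot all_order all_algebra.
From mathcomp Require Import all_classical all_reals all_analysis.

Set Implicit Arguments.
Unset Strict Implicit.
Unset Printing Implicit Defensive.

Import Order.TTheory GRing.Theory Num.Theory.
Local Open Scope classical_set_scope.
Local Open Scope ring_scope.

(* Eigenvalues of a square matrix M, listed in non-increasing order with
   multiplicity: the (unique) non-increasing list s whose linear factors
   multiply to the characteristic polynomial (exists when M = A A^T). *)
Definition eigs_desc {R : realType} {n : nat} (M : 'M[R]_n) : seq R :=
  xget [::] [set s : seq R | sorted (fun x y => y <= x) s /\
                              char_poly M = \prod_(x <- s) ('X - x%:P)].

(* sv A r = sigma_r(A), the r-th largest singular value (r >= 1), i.e. the
   square root of the r-th largest eigenvalue of A A^T. *)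
Definition sv {R : realType} {m n : nat} (A : 'M[R]_(m, n)) (r : nat) : R :=
  Num.sqrt (nth 0 (eigs_desc (A *m A^T)) r.-1).

Definition specnorm {R : realType} {m n : nat} (A : 'M[R]_(m, n)) : R := sv A 1.

Definition enorm {R : realType} {K : nat} (v : 'I_K -> R) : R :=
  Num.sqrt (\sum_(k < K) v k ^+ 2).

Definition LSobj {R : realType} {N T K : nat} (Rf : nat) (Y : 'M[R]_(N, T))
  (X : 'I_K -> 'M[R]_(N, T)) (beta : 'I_K -> R) : R :=
  inf [set v : R | exists (lam : 'M[R]_(N, Rf)) (f : 'M[R]_(T, Rf)),
         v = \sum_(i < N) \sum_(t < T)
               (Y i t - \sum_(k < K) X k i t * beta k - (lam *m f^T) i t) ^+ 2].

Definition is_LS {R : realType} {N T K : nat} (Rf : nat) (Y : 'M[R]_(N, T))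
  (X : 'I_K -> 'M[R]_(N, T)) (beta : 'I_K -> R) : Prop :=
  forall beta' : 'I_K -> R, LSobj Rf Y X beta <= LSobj Rf Y X beta'.

Definition outP {d} {Omega : measurableType d} {R : realType}
  (P : probability Omega R) (A : set Omega) : \bar R :=
  ereal_inf [set P B | B in [set B | measurable B /\ A `<=` B]].

Definition OP {d} {Omega : measurableType d} {R : realType}
  (P : probability Omega R) (X : nat -> nat -> Omega -> R)
  (a : nat -> nat -> R) : Prop :=
  forall e : R, 0 < e -> exists (M : R) (n0 : nat), 0 < M /\
    forall N T : nat, (n0 <= N)%N -> (n0 <= T)%N ->
      Order.le (outP P [set w | M * a N T < `|X N T w|]) (e%:E).

Definition wpa1 {d} {Omega : measurableType d} {R : realType}
  (P : probability Omega R) (E : nat -> nat -> set Omega) : Prop :=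
  forall e : R, 0 < e -> exists n0 : nat,
    forall N T : nat, (n0 <= N)%N -> (n0 <= T)%N ->
      Order.le (outP P (~` E N T)) (e%:E).

(* Main.v *)
Require Import Defs.
From HB Require Import structures.
From mathcomp Require Import all_boot all_order all_algebra.
From mathcomp Require Import all_classical all_reals all_analysis.
From mathcomp Require Import fingroup perm complex.
From mathcomp Require Import zify ring lra.
Import Order.TTheory GRing.Theory Num.Theory.
Import numFieldNormedType.Exports.
Local Open Scope classical_set_scope.
Local Open Scope ring_scope.

(** Write [delta = betahat - beta0] and let [G] be what remains of [Gam] after
    removing its best approximation of rank [r].  Comparing the objective at
    [betahat] and [beta0] gives, up to an arbitrarily small error,
    [|G + eps - Z|^2 <= |G + eps|^2] in Frobenius norm for some
    [Z = delta.X + H] with [H] of rank at most [2r], hence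
    [|Z|^2 <= 2 <G + eps, Z>].  Condition (3) and the Eckart-Young lower bound
    give [|Z|^2 >= b N T |delta|^2], while [<eps, H>] is at most
    [|eps|_op * sqrt (2r) * |H|].  Dividing by [|Z|] bounds [|delta|] by a
    constant times [r^((1-2 rho)/2) + sqrt (r / min(N,T))], which is at least
    as good as the claimed rate.  As the hypothesis on [betahat] is conditional
    on the existence of a minimiser, one also needs that (3) makes the objective
    coercive; the objective is the squared distance to the matrices of rank at
    most [r], so it is continuous. *)

(** * Frobenius inner product *)

Definition ip {R : realType} {m n : nat} (A B : 'M[R]_(m, n)) : R := \tr (A *m B^T).

Lemma ipE {R : realType} {m n : nat} (A B : 'M[R]_(m, n)) :
  ip A B = \sum_i \sum_j A i j * B i j.
Proof.
by apply: eq_bigr => i _; rewrite mxE; apply: eq_bigr => j _; rewrite mxE.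
Qed.

Lemma ipC {R : realType} {m n : nat} (A B : 'M[R]_(m, n)) : ip A B = ip B A.
Proof. by rewrite /ip -mxtrace_tr trmx_mul trmxK. Qed.

Lemma ipDl {R : realType} {m n : nat} (A B C : 'M[R]_(m, n)) :
  ip (A + B) C = ip A C + ip B C.
Proof. by rewrite /ip mulmxDl mxtraceD. Qed.

Lemma ipZl {R : realType} {m n : nat} (a : R) (A B : 'M[R]_(m, n)) :
  ip (a *: A) B = a * ip A B.
Proof. by rewrite /ip -scalemxAl mxtraceZ. Qed.

Lemma ipNl {R : realType} {m n : nat} (A B : 'M[R]_(m, n)) :
  ip (- A) B = - ip A B.
Proof. by rewrite -scaleN1r ipZl mulN1r. Qed.

Lemma ipBl {R : realType} {m n : nat} (A B C : 'M[R]_(m, n)) :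
  ip (A - B) C = ip A C - ip B C.
Proof. by rewrite ipDl ipNl. Qed.

Lemma ipDr {R : realType} {m n : nat} (A B C : 'M[R]_(m, n)) :
  ip A (B + C) = ip A B + ip A C.
Proof. by rewrite ipC ipDl ![ip _ A]ipC. Qed.

Lemma ipZr {R : realType} {m n : nat} (a : R) (A B : 'M[R]_(m, n)) :
  ip A (a *: B) = a * ip A B.
Proof. by rewrite ipC ipZl ipC. Qed.

Lemma ipBr {R : realType} {m n : nat} (A B C : 'M[R]_(m, n)) :
  ip A (B - C) = ip A B - ip A C.
Proof. by rewrite ipC ipBl ![ip _ A]ipC. Qed.

Lemma ip_sqrB {R : realType} {m n : nat} (A B : 'M[R]_(m, n)) :
  ip (A - B) (A - B) = ip A A - 2 * ip A B + ip B B.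
Proof. by rewrite ipBl !ipBr (ipC B A); ring. Qed.

Lemma ip_ge0 {R : realType} {m n : nat} (A : 'M[R]_(m, n)) : 0 <= ip A A.
Proof. by rewrite ipE; do 2!apply: sumr_ge0 => ? _; rewrite -expr2 sqr_ge0. Qed.

Lemma ip_eq0 {R : realType} {m n : nat} (A : 'M[R]_(m, n)) : ip A A = 0 -> A = 0.
Proof.
rewrite ipE => /eqP; rewrite psumr_eq0 => [/allP h|i _]; last first.
  by apply: sumr_ge0 => ? _; rewrite -expr2 sqr_ge0.
apply/matrixP => i j; rewrite mxE; move/(_ i): h.
rewrite mem_index_enum => /(_ isT) /=.
rewrite psumr_eq0 => [/allP/(_ j)|? _]; last by rewrite -expr2 sqr_ge0.
by rewrite mem_index_enum => /(_ isT) /=; rewrite mulf_eq0 orbb => /eqP.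
Qed.

Lemma ip_sumr {R : realType} {m n : nat} (A : 'M[R]_(m, n)) (I : Type) (s : seq I)
  (F : I -> 'M[R]_(m, n)) : ip A (\sum_(k <- s) F k) = \sum_(k <- s) ip A (F k).
Proof.
elim: s => [|k s IH]; last by rewrite !big_cons ipDr IH.
by rewrite !big_nil /ip trmx0 mulmx0 mxtrace0.
Qed.

Definition fro {R : realType} {m n : nat} (A : 'M[R]_(m, n)) : R := Num.sqrt (ip A A).

Lemma fro_ge0 {R : realType} {m n : nat} (A : 'M[R]_(m, n)) : 0 <= fro A.
Proof. exact: sqrtr_ge0. Qed.

Lemma sqr_fro {R : realType} {m n : nat} (A : 'M[R]_(m, n)) : fro A ^+ 2 = ip A A.
Proof. by rewrite sqr_sqrtr // ip_ge0. Qed.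

(** Expand the squared norm of [fro B *: A - fro A *: B]. The null cases come first because the
    result is divided by [fro A * fro B]. *)
Lemma ip_cauchy {R : realType} {m n : nat} (A B : 'M[R]_(m, n)) : ip A B <= fro A * fro B.
Proof.
have [A0|Ap] := eqVneq (fro A) 0.
  have -> : A = 0 by apply: ip_eq0; rewrite -sqr_fro A0 expr0n.
  by rewrite /ip mul0mx mxtrace0 mulr_ge0 ?fro_ge0.
have [B0|Bp] := eqVneq (fro B) 0.
  have -> : B = 0 by apply: ip_eq0; rewrite -sqr_fro B0 expr0n.
  by rewrite /ip trmx0 mulmx0 mxtrace0 mulr_ge0 ?fro_ge0.
have Agt : 0 < fro A by rewrite lt_neqAle eq_sym Ap fro_ge0.
have Bgt : 0 < fro B by rewrite lt_neqAle eq_sym Bp fro_ge0.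
have := ip_ge0 (fro B *: A - fro A *: B).
rewrite ipBl !ipBr !ipZl !ipZr (ipC B A) -!sqr_fro => h.
have {}h : 0 <= (2 * (fro A * fro B)) * (fro A * fro B - ip A B) by move: h; nra.
by move: h; rewrite pmulr_rge0 ?subr_ge0 // mulr_gt0 // mulr_gt0.
Qed.

Lemma froN {R : realType} {m n : nat} (A : 'M[R]_(m, n)) : fro (- A) = fro A.
Proof. by rewrite /fro ipNl ipC ipNl opprK. Qed.

Lemma froZ {R : realType} {m n : nat} (a : R) (A : 'M[R]_(m, n)) :
  fro (a *: A) = `|a| * fro A.
Proof. by rewrite /fro ipZl ipZr mulrA -expr2 sqrtrM ?sqr_ge0 // sqrtr_sqr. Qed.

Lemma fro_triangle {R : realType} {m n : nat} (A B : 'M[R]_(m, n)) :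
  fro (A + B) <= fro A + fro B.
Proof.
rewrite -(@ler_pXn2r _ 2) // ?nnegrE ?addr_ge0 ?fro_ge0 //.
rewrite sqr_fro ipDl !ipDr (ipC B A) -!sqr_fro.
by have := ip_cauchy A B; nra.
Qed.

Lemma fro_sum {R : realType} {m n : nat} (I : Type) (s : seq I) (F : I -> 'M[R]_(m, n)) :
  fro (\sum_(k <- s) F k) <= \sum_(k <- s) fro (F k).
Proof.
elim: s => [|k s IH]; first by rewrite !big_nil /fro /ip mul0mx mxtrace0 sqrtr0.
by rewrite !big_cons (le_trans (fro_triangle _ _)) // lerD2l.
Qed.

(** * Spectral theorem for real symmetric matrices *)

Lemma sum_Complex {R : realType} (I : Type) (s : seq I) (F G : I -> R) :
  \sum_(k <- s) Complex (F k) (G k) = Complex (\sum_(k <- s) F k) (\sum_(k <- s) G k).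
Proof. by elim: s => [|k s IH]; rewrite ?big_nil // !big_cons IH. Qed.

(** The characteristic polynomial has a complex root $a+ib$. The real and imaginary parts $x,y$ of
    an eigenvector satisfy $xS=ax-by$ and $yS=ay+bx$, so symmetry of $S$ gives $b(|x|^2+|y|^2)=0$.
    Hence $b=0$, and whichever of $x,y$ is nonzero can be normalised. *)
Lemma symmetric_eigenvector {R : realType} {n : nat} (S : 'M[R]_n.+1) :
  S^T = S -> exists (a : R) (v : 'rV[R]_n.+1), ip v v = 1 /\ v *m S = a *: v.
Proof.
move=> symS.
pose f := (real_complex R : {rmorphism R -> R[i]}).
have [l] : exists l : R[i], root (char_poly (map_mx f S)) l.
  by apply/closed_rootP; rewrite size_char_poly.
rewrite -eigenvalue_root_char => /eigenvalueP[v vS v0].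
pose x := map_mx (@complex.Re R) v; pose y := map_mx (@complex.Im R) v.
have vE i j : v i j = Complex (x i j) (y i j) by rewrite !mxE; case: (v i j).
case: l vS => a b vS.
have key i j : Complex ((x *m S) i j) ((y *m S) i j)
    = Complex (a * x i j - b * y i j) (a * y i j + b * x i j).
  have -> : Complex (a * x i j - b * y i j) (a * y i j + b * x i j)
      = (v *m map_mx f S) i j by rewrite vS [RHS]mxE vE.
  rewrite ![(_ *m _) i j]mxE.
  rewrite [RHS](eq_bigr (fun k => Complex (x i k * S k j) (y i k * S k j))); last first.
    by move=> k _; rewrite vE [map_mx f S _ _]mxE /f /=; simpc.
  by rewrite sum_Complex.
have xS : x *m S = a *: x - b *: y.
  by apply/matrixP => i j; case: (key i j) => + _; rewrite !mxE.
have yS : y *m S = a *: y + b *: x.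
  by apply/matrixP => i j; case: (key i j) => _ +; rewrite !mxE.
have h : ip (x *m S) y = ip x (y *m S).
  by rewrite /ip trmx_mul symS mulmxA.
have xy0 : ip x x + ip y y != 0.
  rewrite paddr_eq0 ?ip_ge0 //; apply/negP => /andP[/eqP/ip_eq0 x0 /eqP/ip_eq0 y0].
  move/negP: v0; apply; apply/eqP/matrixP => i j.
  by rewrite vE x0 y0 !mxE.
have b0 : b = 0.
  move: h; rewrite xS yS ipBl ipDr !ipZl !ipZr => h.
  have : b * (ip x x + ip y y) = 0 by lra.
  by move/eqP; rewrite mulf_eq0 (negbTE xy0) orbF => /eqP.
have [u u0 uS] : exists2 u : 'rV[R]_n.+1, ip u u != 0 & u *m S = a *: u.
  have [x0|x0] := eqVneq (ip x x) 0.
    by exists y; [by move: xy0; rewrite x0 add0r | rewrite yS b0 scale0r addr0].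
  by exists x => //; rewrite xS b0 scale0r subr0.
exists a, ((fro u)^-1 *: u); split.
  by rewrite ipZl ipZr -sqr_fro expr2; field; move: u0; rewrite -sqr_fro sqrf_eq0.
by rewrite -scalemxAl uS !scalerA mulrC.
Qed.

(** Serves to deflate an eigenvector in [real_spectral]. The case [v = e] is separate because the
    reflection vector [e - v] vanishes there. *)
Lemma orthogonal_first_row {R : realType} {n : nat} (v : 'rV[R]_n.+1) :
  ip v v = 1 -> exists2 H : 'M[R]_n.+1, H *m H^T = 1%:M & row 0 H = v.
Proof.
move=> v1; pose e : 'rV[R]_n.+1 := delta_mx 0 0.
have e1 : ip e e = 1 by rewrite /ip trmx_delta mul_delta_mx trace_mx11 mxE !eqxx.
have [->|ev] := eqVneq v e.
  by exists 1%:M; rewrite ?trmx1 ?mul1mx // row1.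
have [u uE] : exists u, u = e - v by exists (e - v).
have u0 : ip u u != 0.
  by apply/eqP => /ip_eq0/eqP; rewrite uE subr_eq0 eq_sym (negbTE ev).
have uu (w z : 'rV[R]_n.+1) : w *m z^T = (ip w z)%:M by rewrite [LHS]mx11_scalar /ip trace_mx11.
pose c := 2 / ip u u.
(* the Householder reflection exchanging [e] and [v] *)
pose H : 'M[R]_n.+1 := 1%:M - c *: (u^T *m u).
have HT : H^T = H by rewrite /H linearB /= linearZ /= trmx_mul trmxK trmx1.
exists H.
  rewrite HT {1}/H mulmxBl mul1mx /H
    mulmxBr mulmx1 -!scalemxAl -!scalemxAr.
  rewrite -mulmxA (mulmxA u) uu mul_scalar_mx -scalemxAr !scalerA.
  move: (u^T *m u) => M; apply/matrixP => i j; rewrite !mxE /c.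
  by field.
rewrite rowE -/e /H mulmxBr mulmx1 -scalemxAr mulmxA uu mul_scalar_mx scalerA.
(* Both vectors are unit, so $|e-v|^2 = 2-2\langle e,v\rangle = 2\langle e,e-v\rangle$. *)
have -> : c * ip e u = 1.
  have E : ip u u = 2 - 2 * ip e v by rewrite uE ipBl !ipBr e1 v1 (ipC v e); ring.
  have E2 : ip e u = 1 - ip e v by rewrite uE ipBr e1.
  rewrite /c E2 E; field.
  by move: u0; rewrite E.
by rewrite scale1r uE opprB addrC subrK.
Qed.

(** Deflation: in an orthonormal basis starting with an eigenvector, the first row of [S] is a
    multiple of the first basis vector. Symmetry then clears the first column, and the induction
    hypothesis diagonalises the remaining block. *)
Theorem real_spectral {R : realType} {n : nat} (S : 'M[R]_n) : S^T = S ->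
  exists (Q : 'M[R]_n) (d : 'rV[R]_n), Q *m Q^T = 1%:M /\ S = Q^T *m diag_mx d *m Q.
Proof.
elim: n S => [|n IH] S symS.
  by exists 1%:M, 0; split; apply/matrixP => -[].
have [a [v [v1 vS]]] := symmetric_eigenvector S symS.
have [H HH Hv] := orthogonal_first_row v v1.
have HtH : H^T *m H = 1%:M by exact: mulmx1C.
pose S1 : 'M[R]_(1 + n) := H *m S *m H^T.
have symS1 : S1^T = S1 by rewrite /S1 !trmx_mul trmxK symS mulmxA.
have row0 : row 0 S1 = a *: row 0 1%:M.
  by rewrite /S1 -HH !row_mul Hv vS scalemxAl.
have ur0 : ursubmx S1 = 0.
  apply/matrixP => i j; rewrite !mxE (ord1 i).
  have := congr1 (fun r : 'rV_n.+1 => r 0 (rshift 1 j)) row0.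
  rewrite !mxE.
  have -> : lshift n 0 = ord0 :> 'I_(1 + n) by exact: val_inj.
  by move=> ->; rewrite mulr0.
have ul0 : ulsubmx S1 = a%:M.
  apply/matrixP => i j; rewrite !mxE (ord1 i) (ord1 j).
  have := congr1 (fun r : 'rV_n.+1 => r 0 0) row0.
  rewrite !mxE eqxx mulr1.
  by have -> : lshift n 0 = ord0 :> 'I_(1 + n) by exact: val_inj.
have dl0 : dlsubmx S1 = 0 by rewrite -symS1 -trmx_ursub ur0 trmx0.
have [Q [d [QQ Sd]]] : exists (Q : 'M[R]_n) (d : 'rV[R]_n),
    Q *m Q^T = 1%:M /\ drsubmx S1 = Q^T *m diag_mx d *m Q.
  by apply: IH; rewrite trmx_drsub symS1.
pose B : 'M[R]_(1 + n) := block_mx 1%:M 0 0 Q.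
have BT : B^T = block_mx 1%:M 0 0 Q^T by rewrite /B tr_block_mx trmx1 !trmx0.
have BB : B *m B^T = 1%:M.
  rewrite BT /B mulmx_block !mulmx0 !mul0mx !addr0 !add0r mulmx1 QQ.
  by rewrite -scalar_mx_block.
have S1E : S1 = B^T *m diag_mx (row_mx a%:M d) *m B.
  rewrite -[S1]submxK ur0 ul0 dl0 Sd BT /B diag_mx_row.
  rewrite !mulmx_block !mulmx0 !mul0mx !addr0 !add0r !mulmx1 !mul1mx.
  congr block_mx; last by rewrite mul0mx.
  by apply/matrixP => i j; rewrite !mxE !ord1 eqxx.
exists (B *m (H : 'M[R]_(1 + n))), (row_mx a%:M d); split.
  by rewrite trmx_mul mulmxA -(mulmxA B) HH mulmx1; exact: BB.
transitivity (H^T *m S1 *m H).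
  by rewrite /S1 !mulmxA HtH mul1mx -mulmxA HtH mulmx1.
by rewrite S1E trmx_mul !mulmxA.
Qed.

Lemma char_poly_spectral {R : realType} {n : nat} (Q : 'M[R]_n) (d : 'rV[R]_n) :
  Q *m Q^T = 1%:M ->
  char_poly (Q^T *m diag_mx d *m Q) = \prod_(x <- [seq d 0 i | i <- enum 'I_n]) ('X - x%:P).
Proof.
move=> QQ; have QtQ := mulmx1C QQ.
rewrite big_map big_enum /=.
transitivity (char_poly (diag_mx d)); last first.
  rewrite char_poly_trig ?diag_mx_is_trig //.
  by apply: eq_bigr => i _; rewrite mxE eqxx.
rewrite /char_poly /char_poly_mx.
have -> : 'X%:M - map_mx polyC (Q^T *m diag_mx d *m Q)
   = map_mx polyC Q^T *m ('X%:M - map_mx polyC (diag_mx d)) *m map_mx polyC Q.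
  rewrite mulmxBr mulmxBl -!map_mxM; congr (_ - _).
  by rewrite mul_mx_scalar -scalemxAl -map_mxM QtQ map_mx1 scalemx1.
by rewrite !det_mulmx mulrAC -det_mulmx -map_mxM QtQ map_mx1 det1 mul1r.
Qed.

(** The sorted diagonal of a spectral decomposition lies in the set defining [eigs_desc], so [xget]
    does not fall back on its default. Unique factorisation makes the chosen list a permutation of
    that diagonal, and the permutation matrix is absorbed into [Q]. *)
Lemma eigs_desc_spectral {R : realType} {n : nat} (S : 'M[R]_n) : S^T = S ->
  [/\ size (eigs_desc S) = n,
      forall i j, (i <= j < n)%N -> (eigs_desc S)`_j <= (eigs_desc S)`_i &
      exists2 Q : 'M[R]_n, Q *m Q^T = 1%:M &
        S = Q^T *m diag_mx (\row_i (eigs_desc S)`_i) *m Q].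
Proof.
move=> symS; have [Q [d [QQ SE]]] := real_spectral S symS.
pose t := [tuple d 0 i | i < n].
have tE : tval t = [seq d 0 i | i <- enum 'I_n] by [].
have cS : char_poly S = \prod_(x <- t) ('X - x%:P).
  by rewrite [in LHS]SE char_poly_spectral // tE.
have : [set s : seq R | sorted (fun x y => y <= x) s /\
         char_poly S = \prod_(x <- s) ('X - x%:P)] (eigs_desc S).
  apply: (@xgetPex _ [::]); exists (sort (fun x y => y <= x) t); split.
    by apply: sort_sorted => x y; apply: le_total.
  by rewrite cS; apply: perm_big; rewrite perm_sym perm_sort.
move: (eigs_desc S) => s /= [sorts prods].
have sizes : size s = n.
  have : perm_eq s t by apply: prod_XsubC_eq; rewrite -prods.
  by move/perm_size; rewrite size_tuple.
have /tuple_permP[p pE] : perm_eq s t by apply: prod_XsubC_eq; rewrite -prods.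
have sE (i : 'I_n) : s`_i = d 0 (p i).
  rewrite pE -tnth_nth tnth_map tnth_ord_tuple /t tnth_mktuple.
  by [].
split=> //.
  move=> i j /andP[ij jn].
  apply: (@sorted_leq_nth _ (fun x y => y <= x)) => //; rewrite ?inE ?sizes //.
    by move=> x y z yx xz; apply: le_trans xz yx.
  exact: leq_ltn_trans jn.
exists (perm_mx p *m Q).
  by rewrite trmx_mul mulmxA -(mulmxA (perm_mx p)) QQ mulmx1 tr_perm_mx -perm_mxM mulgV perm_mx1.
have PD : perm_mx p *m diag_mx d = diag_mx (\row_i s`_i) *m perm_mx p.
  rewrite -row_permE -[p in RHS]invgK -col_permE; apply/matrixP => i j; rewrite !mxE sE.
  by rewrite -[i == _](inj_eq (@perm_inj _ p)) permKV.
rewrite trmx_mul -!mulmxA (mulmxA (diag_mx (\row_i s`_i))) -PD tr_perm_mx.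
by rewrite (mulmxA (perm_mx p^-1)) (mulmxA (perm_mx p^-1)) -perm_mxM mulVg perm_mx1 mul1mx mulmxA.
Qed.

(** * Low-rank approximation *)

(** Indexed from zero: the value at [i] is $\sigma_{i+1}(A)^2$, see [sqr_sv]. *)
Definition gram_eig {R : realType} {m n : nat} (A : 'M[R]_(m, n)) (i : nat) : R :=
  (eigs_desc (A *m A^T))`_i.

Lemma gram_sym {R : realType} {m n : nat} (A : 'M[R]_(m, n)) : (A *m A^T)^T = A *m A^T.
Proof. by rewrite trmx_mul trmxK. Qed.

Lemma gram_spectral {R : realType} {m n : nat} (A : 'M[R]_(m, n)) :
  exists2 Q : 'M[R]_m, Q *m Q^T = 1%:M &
    A *m A^T = Q^T *m diag_mx (\row_i gram_eig A i) *m Q.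
Proof. by have [_ _ ?] := eigs_desc_spectral _ (gram_sym A). Qed.

Lemma gram_eig_default {R : realType} {m n : nat} (A : 'M[R]_(m, n)) i :
  (m <= i)%N -> gram_eig A i = 0.
Proof.
by move=> mi; rewrite /gram_eig nth_default //; have [-> _ _] := eigs_desc_spectral _ (gram_sym A).
Qed.

Lemma gram_eigE {R : realType} {m n : nat} (A : 'M[R]_(m, n)) (Q : 'M[R]_m) :
  Q *m Q^T = 1%:M -> A *m A^T = Q^T *m diag_mx (\row_i gram_eig A i) *m Q ->
  (Q *m A) *m (Q *m A)^T = diag_mx (\row_i gram_eig A i).
Proof.
move=> QQ AE; rewrite trmx_mul mulmxA -(mulmxA Q) AE !mulmxA QQ mul1mx.
by rewrite -mulmxA QQ mulmx1.
Qed.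

Lemma gram_eig_ge0 {R : realType} {m n : nat} (A : 'M[R]_(m, n)) i : 0 <= gram_eig A i.
Proof.
have [mi|im] := leqP m i; first by rewrite gram_eig_default.
have [Q QQ AE] := gram_spectral A.
have := congr1 (fun M : 'M[R]_m => M (Ordinal im) (Ordinal im)) (gram_eigE A Q QQ AE).
rewrite [RHS]mxE eqxx !mxE /= mulr1n => <-.
by apply: sumr_ge0 => j _; rewrite [_^T _ _]mxE -expr2 sqr_ge0.
Qed.

Lemma gram_eig_le {R : realType} {m n : nat} (A : 'M[R]_(m, n)) i j :
  (i <= j)%N -> gram_eig A j <= gram_eig A i.
Proof.
move=> ij; have [mj|jm] := leqP m j.
  by rewrite gram_eig_default // gram_eig_ge0.
by have [_ + _] := eigs_desc_spectral _ (gram_sym A); apply; rewrite ij.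
Qed.

Lemma sqr_sv {R : realType} {m n : nat} (A : 'M[R]_(m, n)) r :
  sv A r ^+ 2 = gram_eig A r.-1.
Proof. by rewrite sqr_sqrtr // gram_eig_ge0. Qed.

(** Otherwise the eigenvalues of index at most [i] are all positive, and the leading block of size
    [i.+1] of the diagonalised Gram matrix is invertible. But that block factors through the [r]
    columns of [C], so its rank is at most [r]. *)
Lemma gram_eig_rank {R : realType} {m n r : nat} (C : 'M[R]_(m, r)) (D : 'M[R]_(r, n)) i :
  (r <= i)%N -> gram_eig (C *m D) i = 0.
Proof.
move=> ri; have [mi|im] := leqP m i; first by rewrite gram_eig_default.
have [Q QQ AE] := gram_spectral (C *m D).
apply/eqP; apply: contraTT ri => si; rewrite -ltnNge.
(* [B] selects the first [i.+1] coordinates. *)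
pose B : 'M[R]_(i.+1, m) := pid_mx i.+1.
have BB : B *m (diag_mx (\row_j gram_eig (C *m D) j)) *m B^T
    = diag_mx (\row_(j < i.+1) gram_eig (C *m D) j).
  apply/matrixP => a b; rewrite !mxE.
  have ale : (a < m)%N by apply: leq_trans im.
  rewrite (bigD1 (Ordinal ale)) //= big1 ?addr0 => [|k ka].
    rewrite !mxE (bigD1 (Ordinal ale)) //= big1 ?addr0 => [|l la].
      rewrite !mxE /= !eqxx !ltn_ord /= mul1r mulr1n.
      by rewrite eq_sym; case: eqP => [/val_inj->|]; rewrite ?eqxx ?mulr1 // mulr0; case: eqP => // ->.
    rewrite !mxE; case: (a =P l :> nat) => [al|]; last by rewrite mul0r.
    by case/eqP: la; apply: val_inj.
  rewrite !mxE big1 ?mul0r // => l _; rewrite !mxE.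
  case: (a =P l :> nat) => [al|]; last by rewrite mul0r.
  case: (l =P k) => [lk|]; last by rewrite mulr0.
  by case/eqP: ka; apply: val_inj => /=; rewrite al lk.
have U : diag_mx (\row_(j < i.+1) gram_eig (C *m D) j) \in unitmx.
  rewrite unitmxE det_diag unitfE; apply/prodf_neq0 => j _; rewrite mxE.
  rewrite gt_eqF // (lt_le_trans _ (gram_eig_le _ _ _ (ltn_ord j : (j <= i)%N))) //.
  by rewrite lt_neqAle eq_sym si gram_eig_ge0.
have := mxrank_unit U; rewrite -BB -(gram_eigE _ Q QQ AE) => <-.
rewrite !mulmxA -!mulmxA mulmxA (mulmxA (B *m Q)).
by apply: leq_trans (mxrankM_maxl _ _) _; apply: rank_leq_col.
Qed.

(** * Orthogonal projections and the Eckart-Young theorem *)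

Definition orth_proj {R : realType} {m : nat} (P : 'M[R]_m) : Prop := P^T = P /\ P *m P = P.

Lemma ip_proj {R : realType} {m n : nat} (P : 'M[R]_m) (A B : 'M[R]_(m, n)) :
  orth_proj P -> ip (P *m A) (P *m B) = ip (P *m A) B.
Proof.
move=> [PT PP]; rewrite /ip trmx_mul PT mxtrace_mulC [RHS]mxtrace_mulC.
by rewrite -!mulmxA (mulmxA P P) PP.
Qed.

Lemma ip_projC {R : realType} {m n : nat} (P : 'M[R]_m) (A B : 'M[R]_(m, n)) :
  orth_proj P -> ip (P *m A) B = ip A (P *m B).
Proof. by move=> oP; rewrite -ip_proj // ipC ip_proj // ipC. Qed.

Lemma ip_proj_compl {R : realType} {m n : nat} (P : 'M[R]_m) (A : 'M[R]_(m, n)) :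
  orth_proj P -> ip (A - P *m A) (A - P *m A) = ip A A - ip (P *m A) A.
Proof. by move=> oP; rewrite ipBl !ipBr ip_proj // subrr subr0 [in LHS]ipC. Qed.

(** The weights are the diagonal entries of [P] in an eigenbasis of [A *m A^T]. A symmetric
    idempotent [W] has $W_{ii}=\sum_j W_{ij}^2\ge W_{ii}^2$, which places them in $[0,1]$. *)
Lemma proj_weights {R : realType} {m n : nat} (A : 'M[R]_(m, n)) (P : 'M[R]_m) :
  orth_proj P ->
  exists w : 'I_m -> R, [/\ forall i, 0 <= w i <= 1, \sum_i w i = \tr P &
    ip (P *m A) A = \sum_i w i * gram_eig A i].
Proof.
move=> [PT PP]; have [Q QQ AE] := gram_spectral A.
have QtQ := mulmx1C QQ.
pose W := Q *m P *m Q^T; exists (fun i => W i i); split.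
- move=> i.
  have WW : W *m W^T = W.
    by rewrite /W !trmx_mul trmxK PT !mulmxA -(mulmxA _ Q^T) QtQ mulmx1 -(mulmxA Q) PP.
  have : W i i = \sum_j W i j ^+ 2.
    by rewrite -[in LHS]WW mxE; apply: eq_bigr => j _; rewrite [W^T _ _]mxE expr2.
  rewrite (bigD1 i) //= => Wi.
  have : 0 <= \sum_(j | j != i) W i j ^+ 2 by apply: sumr_ge0 => j _; apply: sqr_ge0.
  by move: Wi; nra.
- by rewrite -[LHS]/(\tr W) /W mxtrace_mulC mulmxA QtQ mul1mx.
rewrite /ip -mulmxA AE !mulmxA mxtrace_mulC !mulmxA -/W.
by apply: eq_bigr => i _; rewrite mul_mx_diag !mxE.
Qed.

Lemma ip_gram_eig {R : realType} {m n : nat} (A : 'M[R]_(m, n)) :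
  ip A A = \sum_(i < m) gram_eig A i.
Proof.
have [Q QQ AE] := gram_spectral A.
rewrite /ip AE mxtrace_mulC mulmxA QQ mul1mx mxtrace_diag.
by apply: eq_bigr => i _; rewrite mxE.
Qed.

Lemma sum_ltn_ord {R : realType} (m r : nat) :
  \sum_(i < m) ((i < r)%N)%:R = (minn m r)%:R :> R.
Proof.
elim: m => [|m IH]; first by rewrite big_ord0 min0n.
rewrite big_ord_recr /= IH -natrD; congr _%:R.
by case: ltnP => h; rewrite /minn; case: ltnP; case: ltnP; lia.
Qed.

(** Puts a tail sum in weighted form, to be compared term by term with the weights of
    [proj_weights]. *)
Lemma sum_tail_ord {R : realType} (m r : nat) (F : nat -> R) :
  \sum_(i < m) (1 - ((i < r)%N)%:R) * F i = \sum_(r <= i < m) F i.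
Proof.
rewrite big_geq_mkord big_mkcond [RHS]big_mkcond /=; apply: eq_bigr => i _.
by case: ltnP => h; rewrite ?subrr ?mul0r ?subr0 ?mul1r.
Qed.

(** [U] collects the first [r] eigenvectors of [A *m A^T]. The trace is only bounded by [r] because
    [r] may exceed [m]. *)
Lemma top_proj {R : realType} {m n : nat} (A : 'M[R]_(m, n)) (r : nat) :
  exists2 U : 'M[R]_(m, r), orth_proj (U *m U^T) /\ \tr (U *m U^T) <= r%:R &
    ip (A - U *m U^T *m A) (A - U *m U^T *m A) = \sum_(r <= i < m) gram_eig A i.
Proof.
have [Q QQ AE] := gram_spectral A.
have QtQ := mulmx1C QQ.
pose U : 'M[R]_(m, r) := Q^T *m pid_mx r.
have UU : U *m U^T = Q^T *m pid_mx r *m Q.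
  rewrite /U trmx_mul trmxK tr_pid_mx mulmxA -(mulmxA Q^T) mul_pid_mx.
  by rewrite !minnn.
have pp : (pid_mx r : 'M[R]_m) *m (pid_mx r : 'M[R]_m) = pid_mx r.
  by rewrite mul_pid_mx minnn pid_mx_minh.
have oP : orth_proj (U *m U^T).
  split; first by rewrite trmx_mul trmxK.
  by rewrite UU !mulmxA -(mulmxA _ Q) QQ mulmx1 -(mulmxA Q^T) pp.
exists U.
  split=> //; rewrite UU mxtrace_mulC mulmxA QQ mul1mx.
  have -> : \tr (pid_mx r : 'M[R]_m) = \sum_(i < m) ((i < r)%N)%:R.
    by apply: eq_bigr => i _; rewrite mxE eqxx.
  by rewrite sum_ltn_ord ler_nat geq_minr.
rewrite ip_proj_compl // ip_gram_eig UU /ip -mulmxA AE !mulmxA -(mulmxA _ Q) QQ mulmx1.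
rewrite mxtrace_mulC !mulmxA QQ mul1mx -sum_tail_ord -sumrB.
apply: eq_bigr => i _; rewrite mul_mx_diag !mxE eqxx /=; ring.
Qed.

(** Project on the top [r] eigenvectors of the product itself: the squared residual is the sum of
    the eigenvalues of index at least [r], all zero by [gram_eig_rank]. *)
Lemma lowrank_proj {R : realType} {m n r : nat} (C : 'M[R]_(m, r)) (D : 'M[R]_(r, n)) :
  exists2 P : 'M[R]_m, orth_proj P /\ \tr P <= r%:R & P *m (C *m D) = C *m D.
Proof.
have [U [oP trP] UE] := top_proj (C *m D) r.
exists (U *m U^T) => //; apply/esym/eqP; rewrite -subr_eq0; apply/eqP/ip_eq0.
rewrite UE big_nat_cond big1 // => i /andP[/andP[ri _] _].
exact: gram_eig_rank.
Qed.

(** Let [P] fix [C *m D]. Applying [1 - P] to [A - C *m D] leaves [A - P *m A] and does not increase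
    the norm, so the error is at least $\sum_i(1-w_i)\lambda_i$ with the weights of
    [proj_weights]. *)
Lemma eckart_young_lower_gram {R : realType} {m n r : nat} (A : 'M[R]_(m, n))
  (C : 'M[R]_(m, r)) (D : 'M[R]_(r, n)) :
  \sum_(r <= i < m) gram_eig A i <= ip (A - C *m D) (A - C *m D).
Proof.
have [P [oP trP] PH] := lowrank_proj C D.
have [w [w01 ws wA]] := proj_weights A P oP.
set B := A - C *m D.
have h : ip (A - P *m A) (A - P *m A) <= ip B B.
  have -> : A - P *m A = B - P *m B.
    by rewrite /B mulmxBr PH opprB addrA subrK.
  by rewrite ip_proj_compl // gerBl -ip_proj // ip_ge0.
apply: le_trans h; rewrite ip_proj_compl // wA ip_gram_eig -sum_tail_ord -subr_ge0 -!sumrB.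
(* Ky Fan: as the weights sum to at most [r], replacing every eigenvalue by the one of
   index [r] leaves a nonnegative lower bound. *)
apply: (@le_trans _ _ (\sum_(i < m) (((i < r)%N)%:R - w i) * gram_eig A r)).
  rewrite -mulr_suml sumrB sum_ltn_ord ws.
  have [mr|rm] := leqP m r; first by rewrite gram_eig_default // mulr0.
  by rewrite mulr_ge0 ?gram_eig_ge0 // subr_ge0.
apply: ler_sum => i _; have /andP[w0 w1] := w01 i.
by case: ltnP => /= ir; [have := gram_eig_le A _ _ (ltnW ir)|have := gram_eig_le A _ _ ir]; nra.
Qed.

Lemma gram_tail_sv {R : realType} {m n : nat} (A : 'M[R]_(m, n)) (r : nat) :
  \sum_(r <= i < m) gram_eig A i = \sum_(r.+1 <= i < (minn m n).+1) sv A i ^+ 2.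
Proof.
rewrite big_add1 /=; under [RHS]eq_bigr do rewrite sqr_sv /=.
have [nm|//] := leqP n m.
have z i : (n <= i)%N -> gram_eig A i = 0.
  (* Written as [A *m 1%:M], the matrix factors through [n] columns. *)
  by rewrite -[in gram_eig _ _](mulmx1 A); apply: gram_eig_rank.
have [rn|nr] := leqP r n.
  rewrite (big_cat_nat rn nm) /= [X in _ + X]big_nat_cond [X in _ + X]big1 ?addr0 //.
  by move=> i /andP[/andP[+ _] _]; apply: z.
rewrite [RHS]big_geq ?(ltnW nr) // big_nat_cond big1 // => i /andP[/andP[ri _] _].
by apply: z; apply: leq_trans (ltnW nr) ri.
Qed.

Lemma eckart_young_lower {R : realType} {m n r : nat} (A : 'M[R]_(m, n))
  (C : 'M[R]_(m, r)) (D : 'M[R]_(r, n)) :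
  \sum_(r.+1 <= i < (minn m n).+1) sv A i ^+ 2 <= fro (A - C *m D) ^+ 2.
Proof. by rewrite -gram_tail_sv sqr_fro eckart_young_lower_gram. Qed.

Lemma eckart_young_attained {R : realType} {m n : nat} (A : 'M[R]_(m, n)) (r : nat) :
  exists (C : 'M[R]_(m, r)) (D : 'M[R]_(n, r)),
    fro (A - C *m D^T) ^+ 2 = \sum_(r.+1 <= i < (minn m n).+1) sv A i ^+ 2.
Proof.
have [U _ UE] := top_proj A r.
exists U, (U^T *m A)^T; by rewrite trmxK mulmxA sqr_fro UE gram_tail_sv.
Qed.

(** With [P] fixing [C *m D], the pairing only sees [P *m E], whose squared norm $\sum_i
    w_i\lambda_i$ is at most $r\lambda_0$. *)
Lemma ip_lowrank {R : realType} {m n r : nat} (E : 'M[R]_(m, n))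
  (C : 'M[R]_(m, r)) (D : 'M[R]_(r, n)) :
  ip E (C *m D) <= specnorm E * Num.sqrt r%:R * fro (C *m D).
Proof.
have [P [oP trP] PH] := lowrank_proj C D.
have [w [w01 ws wA]] := proj_weights E P oP.
rewrite -PH -ip_projC // PH (le_trans (ip_cauchy _ _)) // ler_wpM2r ?fro_ge0 //.
rewrite -(@ler_pXn2r _ 2) ?nnegrE ?mulr_ge0 ?fro_ge0 ?sqrtr_ge0 //.
rewrite exprMn /specnorm sqr_sv sqr_fro ip_proj // wA sqr_sqrtr ?ler0n //=.
apply: (@le_trans _ _ (\sum_i w i * gram_eig E 0)).
  by apply: ler_sum => i _; have /andP[w0 _] := w01 i; rewrite ler_wpM2l // gram_eig_le.
by rewrite -mulr_suml ws mulrC ler_wpM2l // gram_eig_ge0.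
Qed.

(** * Least-squares objective *)

Section InteractiveFixedEffects.
Context {R : realType} {N T K : nat} (X : 'I_K -> 'M[R]_(N, T)).
Implicit Types (beta delta : 'I_K -> R) (Y : 'M[R]_(N, T)).

Definition lincomb beta : 'M[R]_(N, T) := \sum_(k < K) beta k *: X k.

Lemma lincombB beta beta' :
  lincomb (fun k => beta k - beta' k) = lincomb beta - lincomb beta'.
Proof. by rewrite -sumrB; apply: eq_bigr => k _; rewrite scalerBl. Qed.

Lemma lincombZ a beta : lincomb (fun k => a * beta k) = a *: lincomb beta.
Proof. by rewrite scaler_sumr; apply: eq_bigr => k _; rewrite scalerA. Qed.

Lemma enorm_ge0 beta : 0 <= enorm beta.
Proof. exact: sqrtr_ge0. Qed.

Lemma le_enorm beta k : `|beta k| <= enorm beta.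
Proof.
rewrite -sqrtr_sqr ler_sqrt ?sumr_ge0 // => [|? _]; last exact: sqr_ge0.
by rewrite (bigD1 k) //= lerDl sumr_ge0 // => ? _; exact: sqr_ge0.
Qed.

Lemma enormZ a beta : enorm (fun k => a * beta k) = `|a| * enorm beta.
Proof.
rewrite -sqrtr_sqr -sqrtrM ?sqr_ge0 // mulr_sumr.
by congr Num.sqrt; apply: eq_bigr => k _; rewrite exprMn.
Qed.

Lemma fro_lincomb beta : fro (lincomb beta) <= enorm beta * \sum_(k < K) fro (X k).
Proof.
rewrite (le_trans (fro_sum _ _ _)) // mulr_sumr; apply: ler_sum => k _.
by rewrite froZ ler_wpM2r ?fro_ge0 ?le_enorm.
Qed.

Lemma ip_lincomb (A : 'M[R]_(N, T)) beta :
  ip A (lincomb beta) <= enorm beta * \sum_(k < K) `|ip A (X k)|.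
Proof.
rewrite ip_sumr mulr_sumr; apply: ler_sum => k _.
rewrite ipZr (le_trans (ler_norm _)) // normrM.
by rewrite ler_wpM2r ?normr_ge0 ?le_enorm.
Qed.

Section Objective.
Variables (r : nat) (Y : 'M[R]_(N, T)).

(** Repeats the set inside [LSobj] literally, so that its infimum is convertible to [LSobj]. *)
Let residuals beta : set R :=
  [set v : R | exists (lam : 'M[R]_(N, r)) (f : 'M[R]_(T, r)),
     v = \sum_(i < N) \sum_(t < T)
           (Y i t - \sum_(k < K) X k i t * beta k - (lam *m f^T) i t) ^+ 2].

Let residualE beta (lam : 'M[R]_(N, r)) (f : 'M[R]_(T, r)) :
  \sum_(i < N) \sum_(t < T)
    (Y i t - \sum_(k < K) X k i t * beta k - (lam *m f^T) i t) ^+ 2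
  = fro (Y - lincomb beta - lam *m f^T) ^+ 2.
Proof.
rewrite sqr_fro ipE; apply: eq_bigr => i _; apply: eq_bigr => t _.
rewrite -expr2; congr (_ ^+ 2); move: (lam *m f^T) => L; rewrite !mxE summxE.
by congr (_ - _ - _); apply: eq_bigr => k _; rewrite mxE mulrC.
Qed.

Let residuals_lb beta : lbound (residuals beta) 0.
Proof. by move=> v [lam [f ->]]; rewrite residualE sqr_ge0. Qed.

Let residuals_neq0 beta : residuals beta !=set0.
Proof. by eexists; exists 0, 0. Qed.

Lemma LSobj_ge0 beta : 0 <= LSobj r Y X beta.
Proof. by apply: lb_le_inf; [exact: residuals_neq0|exact: residuals_lb]. Qed.

(** The square root is a distance to the matrices of rank at most [r], hence obeys the triangle
    inequality, from which the Lipschitz bound and coercivity follow. *)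
Definition LSdist beta : R := Num.sqrt (LSobj r Y X beta).

Lemma sqr_LSdist beta : LSdist beta ^+ 2 = LSobj r Y X beta.
Proof. by rewrite sqr_sqrtr // LSobj_ge0. Qed.

Lemma LSdist_ge0 beta : 0 <= LSdist beta.
Proof. exact: sqrtr_ge0. Qed.

Lemma LSdist_le beta (lam : 'M[R]_(N, r)) (f : 'M[R]_(T, r)) :
  LSdist beta <= fro (Y - lincomb beta - lam *m f^T).
Proof.
rewrite -(@ler_pXn2r _ 2) ?nnegrE ?LSdist_ge0 ?fro_ge0 // sqr_LSdist.
apply: ge_inf; first by exists 0; exact: residuals_lb.
by exists lam, f; rewrite residualE.
Qed.

Lemma LSdist_approx beta e : 0 < e ->
  exists (lam : 'M[R]_(N, r)) (f : 'M[R]_(T, r)),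
    fro (Y - lincomb beta - lam *m f^T) < LSdist beta + e.
Proof.
(* A slack of $e^2$ in the objective suffices, since $d^2+e^2\le(d+e)^2$ for $d,e\ge0$. *)
move=> e0; have e2 : 0 < e ^+ 2 by rewrite exprn_gt0.
have [|v [lam [f ->]]] := @inf_adherent _ (residuals beta) (e ^+ 2) e2.
  by split; [exact: residuals_neq0|exists 0; exact: residuals_lb].
rewrite residualE -[inf _]/(LSobj r Y X beta) -sqr_LSdist => h; exists lam, f.
rewrite -(@ltr_pXn2r _ 2) ?nnegrE ?fro_ge0 ?addr_ge0 ?LSdist_ge0 ?(ltW e0) //.
by apply: lt_le_trans h _; have := LSdist_ge0 beta; nra.
Qed.

(** Use at [beta] the nearly optimal factors of [beta']. *)
Lemma LSdist_lipschitz beta beta' :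
  LSdist beta <= LSdist beta' + fro (lincomb (fun k => beta' k - beta k)).
Proof.
apply/ler_addgt0Pr => e e0; have [lam [f lt]] := LSdist_approx beta' e e0.
apply: le_trans (LSdist_le beta lam f) _.
have -> : Y - lincomb beta - lam *m f^T
    = (Y - lincomb beta' - lam *m f^T) + lincomb (fun k => beta' k - beta k).
  rewrite lincombB; move: (lam *m _) (lincomb beta) (lincomb beta') => L B B'.
  by apply/matrixP => i j; rewrite !mxE; ring.
by apply: le_trans (fro_triangle _ _) _; lra.
Qed.

Lemma LSdist_coercive kappa beta :
  (forall delta (C : 'M[R]_(N, r)) (D : 'M[R]_(r, T)),
     kappa * enorm delta <= fro (lincomb delta - C *m D)) ->
  kappa * enorm beta <= LSdist beta + fro Y.
Proof.
move=> hk; apply/ler_addgt0Pr => e e0; have [lam [f lt]] := LSdist_approx beta e e0.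
apply: le_trans (hk beta (- lam) f^T) _.
have -> : lincomb beta - (- lam) *m f^T = - (Y - lincomb beta - lam *m f^T) + Y.
  rewrite mulNmx; move: (lam *m _) (lincomb beta) => L B.
  by apply/matrixP => i j; rewrite !mxE; ring.
by apply: le_trans (fro_triangle _ _) _; rewrite froN; lra.
Qed.

Lemma LSdist_continuous : continuous (fun v : 'rV[R]_K => LSdist (fun k => v 0 k)).
Proof.
move=> v; apply/(@cvgrPdist_le _ _ _ _ (nbhs_filter v)) => e e0.
pose c := \sum_(k < K) fro (X k).
have c0 : 0 <= c by apply: sumr_ge0 => k _; exact: fro_ge0.
(* The added 1 covers the case where all regressors vanish. *)
have d0 : 0 < e / (c + 1) by rewrite divr_gt0 // ltr_wpDl.
apply/(@nbhs_ballP R 'rV[R]_K); exists (e / (c + 1)) => //= w [_ vw].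
have small (u : 'I_K -> R) : (forall k, `|u k| <= e / (c + 1)) -> fro (lincomb u) <= e.
  move=> hu; rewrite (le_trans (fro_sum _ _ _)) //.
  apply: (@le_trans _ _ (e / (c + 1) * c)).
    rewrite mulr_sumr; apply: ler_sum => k _.
    by rewrite froZ ler_wpM2r ?fro_ge0 ?hu.
  by rewrite mulrAC ler_pdivrMr ?ltr_wpDl // ler_wpM2l ?(ltW e0) ?lerDl.
have h1 : fro (lincomb (fun k => w 0 k - v 0 k)) <= e.
  by apply: small => k; rewrite distrC; apply/ltW/vw.
have h2 : fro (lincomb (fun k => v 0 k - w 0 k)) <= e.
  by apply: small => k; apply/ltW/vw.
have := LSdist_lipschitz (fun k => v 0 k) (fun k => w 0 k).
have := LSdist_lipschitz (fun k => w 0 k) (fun k => v 0 k).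
by rewrite ler_norml => H1 H2; apply/andP; split; lra.
Qed.

Lemma is_LS_exists kappa : 0 < kappa ->
  (forall delta (C : 'M[R]_(N, r)) (D : 'M[R]_(r, T)),
     kappa * enorm delta <= fro (lincomb delta - C *m D)) ->
  exists beta, is_LS r Y X beta.
Proof.
move=> k0 hk.
(* Outside the cube of half-width [M], coercivity puts [LSdist] above its value at 0, so a minimiser
   over the compact cube is global. *)
pose M := (LSdist (fun=> 0) + fro Y) / kappa.
have M0 : 0 <= M by rewrite divr_ge0 ?addr_ge0 ?LSdist_ge0 ?fro_ge0 ?(ltW k0).
pose A := [set v : 'rV[R]_K | forall k, v ord0 k \in `[- M, M]].
have cA : compact A.
  apply: (@rV_compact _ _ (fun=> `[- M, M]%classic)) => _; exact: segment_compact.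
have A0 : A 0 by move=> k; rewrite mxE in_itv /= oppr_le0 M0.
have [||v _ vmin] := @EVT_min_rV R K (fun v => LSdist (fun k => v 0 k)) A _ cA.
- by exists 0.
- by apply: continuous_subspaceT; exact: LSdist_continuous.
exists (fun k => v 0 k) => beta'.
rewrite -!sqr_LSdist ler_pXn2r ?nnegrE ?LSdist_ge0 //.
have rowK (b : 'I_K -> R) : (fun k => (\row_j b j) 0 k) = b.
  by apply/funext => k; rewrite mxE.
have [inA|] := pselect (A (\row_j beta' j)).
  by have := vmin _ (mem_set inA); rewrite rowK.
move=> /existsNP[k /negP]; rewrite mxE in_itv /= -ler_norml -ltNge => Mk.
apply: (@le_trans _ _ (LSdist (fun=> 0))).
  have := vmin _ (mem_set A0).
  by have -> : (fun k => (0 : 'rV[R]_K) 0 k) = (fun=> 0) by apply/funext => j; rewrite mxE.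
have := LSdist_coercive kappa beta' hk; have := le_enorm beta' k => h1 h2.
have : M * kappa = LSdist (fun=> 0) + fro Y by rewrite /M divfK // gt_eqF.
by move: (lt_le_trans Mk h1) h2; nra.
Qed.

End Objective.

(** The rank [r + r] arises from subtracting two matrices of rank at most [r]: the fitted factor
    part and the approximation [C *m D^T] of [Gam]. The error term is paired with the regressors
    through [c], and with the low-rank part through its spectral norm. *)
Lemma is_LS_bound (r : nat) (beta0 betahat : 'I_K -> R) (Gam eps : 'M[R]_(N, T))
  (C : 'M[R]_(N, r)) (D : 'M[R]_(T, r)) (kappa l c : R) :
  let delta := fun k => betahat k - beta0 k in
  0 < kappa -> 0 <= l -> 0 <= c ->
  (forall delta (C : 'M[R]_(N, r + r)) (D : 'M[R]_(r + r, T)),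
     kappa * enorm delta <= fro (lincomb delta - C *m D)) ->
  fro (lincomb delta) <= enorm delta * l ->
  ip eps (lincomb delta) <= enorm delta * c ->
  is_LS r (lincomb beta0 + Gam + eps) X betahat ->
  kappa * enorm delta <= 4 * (fro (Gam - C *m D^T) + c / kappa
     + specnorm eps * Num.sqrt (r + r)%:R * (1 + l / kappa)).
Proof.
move=> delta k0 l0 c0 hk hl hc hLS.
set G := Gam - C *m D^T; set S := specnorm eps * _; set Y := _ + eps in hLS.
have S0 : 0 <= S by rewrite mulr_ge0 ?sqrtr_ge0.
have F0 : 0 <= fro G by exact: fro_ge0.
have ck : 0 <= c / kappa by rewrite divr_ge0 // ltW.
have lk : 0 <= l / kappa by rewrite divr_ge0 // ltW.
have rhs0 : 0 <= fro G + c / kappa + S * (1 + l / kappa).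
  by rewrite !addr_ge0 // mulr_ge0 // addr_ge0.
have [d0|dn0] := eqVneq (enorm delta) 0; first by rewrite d0 mulr0 mulr_ge0.
have dp : 0 < enorm delta by rewrite lt_neqAle eq_sym dn0 enorm_ge0.
set a := kappa * enorm delta; have ap : 0 < a by exact: mulr_gt0.
have [e e0 he] : exists2 e, 0 < e &
    (fro (G + eps) + e) ^+ 2 <= fro (G + eps) ^+ 2 + a ^+ 2 / 2.
  have g0 := fro_ge0 (G + eps).
  (* With $g$ the norm of [G + eps], this $e$ is at most $a$, so $2ge+e^2\le e(2g+a)=a^2/2$. *)
  exists (a ^+ 2 / (4 * fro (G + eps) + 2 * a)).
    by rewrite divr_gt0 ?exprn_gt0 //; nra.
  set g := fro _ in g0 *; set e := _ / _.
  have q0 : 0 < 4 * g + 2 * a by nra.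
  have eE : e * (4 * g + 2 * a) = a ^+ 2 by rewrite divfK // gt_eqF.
  have e0 : 0 <= e by rewrite divr_ge0 ?sqr_ge0 // ltW.
  have ea : e <= a by rewrite ler_pdivrMr //; nra.
  by nra.
have LSle : LSdist r Y betahat <= fro (G + eps).
  apply: (@le_trans _ _ (LSdist r Y beta0)).
    by rewrite -(@ler_pXn2r _ 2) ?nnegrE ?LSdist_ge0 // !sqr_LSdist; exact: hLS.
  apply: le_trans (LSdist_le _ _ beta0 C D) _.
  rewrite le_eqVlt; apply/orP; left; apply/eqP; congr fro.
  rewrite /G /Y; move: (C *m _) (lincomb beta0) => L B.
  by apply/matrixP => i j; rewrite !mxE; ring.
have [lam [f lt]] := LSdist_approx r Y betahat e e0.
pose H := row_mx lam (- C) *m col_mx f^T D^T.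
have HE : H = lam *m f^T - C *m D^T by rewrite /H mul_row_col mulNmx.
(* The double negation gives [Z] the shape required by [hk]. *)
pose Z := lincomb delta - (- H).
have Za : a <= fro Z by rewrite /Z /H -mulNmx; exact: hk.
have resE : Y - lincomb betahat - lam *m f^T = G + eps - Z.
  rewrite /Z HE /delta lincombB /G /Y.
  move: (lam *m _) (C *m _) (lincomb beta0) (lincomb betahat) => L1 L2 B1 B2.
  by apply/matrixP => i j; rewrite !mxE; ring.
have basic : fro Z ^+ 2 <= 2 * ip (G + eps) Z + a ^+ 2 / 2.
  have h : fro (G + eps - Z) ^+ 2 <= fro (G + eps) ^+ 2 + a ^+ 2 / 2.
    apply: le_trans he; rewrite ler_pXn2r ?nnegrE ?fro_ge0 ?addr_ge0 ?(ltW e0) //.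
      by rewrite -resE (le_trans (ltW lt)) // lerD2r.
    exact: fro_ge0.
  by move: h; rewrite !sqr_fro ip_sqrB; lra.
set z := fro Z in Za basic.
have zd : enorm delta <= z / kappa by rewrite ler_pdivlMr // mulrC.
have z0 : 0 < z by apply: lt_le_trans Za.
have Hz : fro H <= z + enorm delta * l.
  have -> : H = Z - lincomb delta by rewrite /Z opprK addrC addKr.
  by rewrite (le_trans (fro_triangle _ _)) // froN lerD2l.
have b1 : ip (G + eps) Z <= fro G * z + enorm delta * c + S * (z + enorm delta * l).
  rewrite ipDl -addrA lerD ?ip_cauchy // /Z opprK ipDr lerD //.
  by apply: le_trans (ip_lowrank _ _ _) _; rewrite -/H -/S ler_wpM2l.
have b2 : ip (G + eps) Z <= z * (fro G + c / kappa + S * (1 + l / kappa)).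
  apply: le_trans b1 _.
  have h1 : enorm delta * c <= z * (c / kappa).
    by rewrite mulrA mulrAC ler_wpM2r.
  have h2 : enorm delta * l <= z * (l / kappa).
    by rewrite mulrA mulrAC ler_wpM2r.
  have h3 : S * (z + enorm delta * l) <= S * (z + z * (l / kappa)).
    by rewrite ler_wpM2l // lerD2l.
  by move: h3; rewrite !mulrDr mulr1 [z * (S * _)]mulrCA [z * S]mulrC; nra.
set W := fro G + _ + _ in b2 rhs0 *.
(* As $a\le z$, the basic inequality reads $z^2\le 2zW+z^2/2$, whence the factor 4. *)
have : z * z <= z * (4 * W) by move: b2 basic Za ap; nra.
by rewrite ler_pM2l // => zW; apply: le_trans Za zW.
Qed.

(** By homogeneity, scale [delta] to norm one; the Eckart-Young bound then controls what a rank [r]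
    correction can remove. It is applied with $c=\sqrt{NT}$. *)
Lemma sv_coercive (c b : R) (r : nat) : 0 < c -> 0 <= b ->
  (forall delta, enorm delta = 1 ->
     b <= \sum_(r.+1 <= i < (minn N T).+1) sv (c^-1 *: lincomb delta) i ^+ 2) ->
  forall delta (C : 'M[R]_(N, r)) (D : 'M[R]_(r, T)),
    Num.sqrt b * c * enorm delta <= fro (lincomb delta - C *m D).
Proof.
move=> c0 b0 hb delta C D.
have [d0|dn0] := eqVneq (enorm delta) 0; first by rewrite d0 mulr0 fro_ge0.
have dp : 0 < enorm delta by rewrite lt_neqAle eq_sym dn0 enorm_ge0.
have h : b <= fro ((c * enorm delta)^-1 *: (lincomb delta - C *m D)) ^+ 2.
  have /hb/le_trans : enorm (fun k => (enorm delta)^-1 * delta k) = 1.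
    by rewrite enormZ gtr0_norm ?invr_gt0 // mulVf.
  apply; rewrite lincombZ scalerA -invfM scalerBr scalemxAl.
  exact: eckart_young_lower.
have cd : 0 < c * enorm delta by rewrite mulr_gt0.
rewrite -mulrA -ler_pdivlMr // mulrC.
rewrite -[leRHS](_ : fro ((c * enorm delta)^-1 *: (lincomb delta - C *m D)) = _).
  by rewrite -[leRHS]ger0_norm ?fro_ge0 // -sqrtr_sqr ler_sqrt ?sqr_ge0.
by rewrite froZ gtr0_norm // invr_gt0.
Qed.

End InteractiveFixedEffects.

(** * Deterministic rate *)

Lemma le_powR_neg {R : realType} (s x y : R) : s <= 0 -> 0 < x -> x <= y -> y `^ s <= x `^ s.
Proof.
move=> s0 x0 xy; have y0 := lt_le_trans x0 xy.
rewrite -[s]opprK !(powRN _ (- s)) lef_pV2 ?posrE ?powR_gt0 //.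
by apply: ge0_ler_powR => //; rewrite ?oppr_ge0 // nnegrE ltW.
Qed.

(** The probability-free core: all stochastic bounds hold at one sample point, with explicit
    constants that do not depend on [N], [T] or [r]. *)
Lemma is_LS_rate {R : realType} {N T K : nat} (r : nat) (rho b M1 M2 M3 M4 : R)
  (X : 'I_K -> 'M[R]_(N, T)) (Gam eps : 'M[R]_(N, T)) (beta0 betahat : 'I_K -> R) :
  let n : R := (N * T)%:R in
  let delta := fun k => betahat k - beta0 k in
  (0 < N)%N -> (0 < T)%N -> (0 < r)%N -> 0 < b -> 0 <= M1 -> 0 <= M2 -> 0 <= M3 -> 0 <= M4 ->
  (forall k, n^-1 * ip (X k) (X k) <= M1) ->
  specnorm eps <= M2 * Num.sqrt (maxn N T)%:R ->
  \sum_(k < K) `|ip eps (X k)| <= M3 * Num.sqrt n ->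
  (forall delta, enorm delta = 1 ->
     b <= \sum_((2 * r).+1 <= i < (minn N T).+1)
            sv ((Num.sqrt n)^-1 *: lincomb X delta) i ^+ 2) ->
  n^-1 * \sum_(r.+1 <= i < (minn N T).+1) sv Gam i ^+ 2 <= M4 * r%:R `^ (1 - 2 * rho) ->
  ((exists beta, is_LS r (lincomb X beta0 + Gam + eps) X beta) ->
   is_LS r (lincomb X beta0 + Gam + eps) X betahat) ->
  enorm delta <=
    4 / Num.sqrt b * (Num.sqrt M4 + M3 / Num.sqrt b
                      + 2 * M2 * (1 + K%:R * Num.sqrt M1 / Num.sqrt b))
    * (r%:R `^ ((3 - 2 * rho) / 2) + r%:R * (minn N T)%:R `^ (- (1 / 2))).
Proof.
move=> n delta N0 T0 r0 b0 M10 M20 M30 M40 hX hE hXE hB hG hLS.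
have n0 : 0 < n by rewrite ltr0n muln_gt0 N0.
set sn := Num.sqrt n in hXE hB *; have sn0 : 0 < sn by rewrite sqrtr_gt0.
have snn : sn ^+ 2 = n by rewrite sqr_sqrtr // ltW.
have sb0 : 0 < Num.sqrt b by rewrite sqrtr_gt0.
pose kappa := Num.sqrt b * sn; have k0 : 0 < kappa by rewrite mulr_gt0.
have hk : forall delta (C : 'M[R]_(N, r + r)) (D : 'M[R]_(r + r, T)),
    kappa * enorm delta <= fro (lincomb X delta - C *m D).
  by apply: sv_coercive => //; rewrite ?ltW // addnn -mul2n.
(* Coercivity modulo rank [r + r] implies coercivity modulo rank [r], by padding with zero blocks; a
   minimiser therefore exists. *)
have {}hLS : is_LS r (lincomb X beta0 + Gam + eps) X betahat.
  apply: hLS; apply: (is_LS_exists X r _ kappa k0) => d C D.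
  have := hk d (row_mx C 0) (col_mx D 0).
  by rewrite mul_row_col mul0mx addr0.
have [C [D GE]] := eckart_young_attained Gam r.
have fX k : fro (X k) <= Num.sqrt M1 * sn.
  rewrite -sqrtrM // ler_sqrt ?mulr_ge0 // ?(ltW n0) //.
  by rewrite -ler_pdivrMr // mulrC hX.
pose l := K%:R * Num.sqrt M1 * sn.
have l0 : 0 <= l by rewrite !mulr_ge0 ?sqrtr_ge0.
have hl : fro (lincomb X delta) <= enorm delta * l.
  apply: le_trans (fro_lincomb X delta) _; rewrite ler_wpM2l ?enorm_ge0 //.
  apply: (@le_trans _ _ (\sum_(k < K) Num.sqrt M1 * sn)); first exact: ler_sum.
  by rewrite sumr_const card_ord -mulr_natl mulrA.
have c0 : 0 <= M3 * sn by rewrite mulr_ge0 // ltW.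
have hc : ip eps (lincomb X delta) <= enorm delta * (M3 * sn).
  by apply: le_trans (ip_lincomb X eps delta) _; rewrite ler_wpM2l ?enorm_ge0.
have := is_LS_bound X r beta0 betahat Gam eps C D kappa l (M3 * sn) k0 l0 c0 hk hl hc hLS.
rewrite -/delta.
have -> : M3 * sn / kappa = M3 / Num.sqrt b by rewrite /kappa; field; rewrite !gt_eqF.
have -> : l / kappa = K%:R * Num.sqrt M1 / Num.sqrt b.
  by rewrite /l /kappa; field; rewrite !gt_eqF.
set L := 1 + K%:R * _ / _.
have L0 : 0 <= L by rewrite addr_ge0 // divr_ge0 ?mulr_ge0 ?sqrtr_ge0.
clearbody L.
have r1 : 1 <= r%:R :> R by rewrite ler1n.
set ra := _ `^ ((3 - 2 * rho) / 2).
set m := (minn N T)%:R : R.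
have m0 : 0 < m by rewrite ltr0n leq_min N0.
have mE : m `^ (- (1 / 2)) = (Num.sqrt m)^-1.
  by rewrite powRN mul1r powR12_sqrt // ltW.
rewrite mE.
(* Here $\max(N,T)\cdot\min(N,T)=NT$. *)
have maxE : Num.sqrt (maxn N T)%:R = sn / Num.sqrt m.
  have -> : sn = Num.sqrt (maxn N T)%:R * Num.sqrt m.
    rewrite -sqrtrM ?ler0n // -natrM; congr (Num.sqrt _%:R).
    by case: (leqP N T) => _; rewrite // mulnC.
  by rewrite mulfK // gt_eqF // sqrtr_gt0.
have max1 : 1 <= Num.sqrt (maxn N T)%:R :> R.
  by rewrite -[X in X <= _]sqrtr1 ler_sqrt ?ler0n // ler1n leq_max N0.
have rb0 : 0 <= r%:R / Num.sqrt m by rewrite divr_ge0 ?sqrtr_ge0.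
(* Condition (4) yields the exponent $(1-2\rho)/2$, enlarged to $(3-2\rho)/2$ because $r\ge1$. *)
have hF : fro (Gam - C *m D^T) <= sn * (Num.sqrt M4 * ra).
  rewrite -(@ler_pXn2r _ 2) ?nnegrE ?fro_ge0 ?mulr_ge0 ?sqrtr_ge0 ?powR_ge0 // GE.
  rewrite !exprMn snn sqr_sqrtr // -ler_pdivrMl // (le_trans hG) // ler_wpM2l //.
  by rewrite -powR_mulrn ?powR_ge0 // -powRrM ler_powR //; lra.
have hq : Num.sqrt (r + r)%:R <= 2 * r%:R :> R.
  rewrite -(@ler_pXn2r _ 2) ?nnegrE ?mulr_ge0 ?sqrtr_ge0 // sqr_sqrtr ?ler0n // natrD; nra.
have hS : specnorm eps * Num.sqrt (r + r)%:R <= sn * (2 * M2 * (r%:R / Num.sqrt m)).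
  apply: (@le_trans _ _ (M2 * (sn / Num.sqrt m) * (2 * r%:R))).
    by rewrite ler_pM ?sqrtr_ge0 // -maxE.
  by rewrite le_eqVlt; apply/orP; left; apply/eqP; ring.
(* This term lacks the factor [sn]; it is absorbed because $1\le\sqrt{\max(N,T)}$ and $r\ge1$. *)
have hM : M3 / Num.sqrt b <= sn * (M3 / Num.sqrt b * (r%:R / Num.sqrt m)).
  rewrite mulrCA -[X in X <= _]mulr1 ler_wpM2l ?divr_ge0 ?sqrtr_ge0 //.
  by rewrite mulrCA -maxE; nra.
move=> hd.
have : kappa * enorm delta <= sn * (4 * ((Num.sqrt M4 + M3 / Num.sqrt b + 2 * M2 * L)
     * (ra + r%:R / Num.sqrt m))).
  apply: le_trans hd _; rewrite [leRHS]mulrCA ler_wpM2l //.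
  apply: (@le_trans _ _ (sn * (Num.sqrt M4 * ra + M3 / Num.sqrt b * (r%:R / Num.sqrt m)
        + 2 * M2 * (r%:R / Num.sqrt m) * L))).
    rewrite !mulrDr lerD ?lerD // [leRHS]mulrA.
    by rewrite ler_wpM2r.
  rewrite ler_wpM2l ?(ltW sn0) //.
  have ra0 : 0 <= ra by exact: powR_ge0.
  have x1 : 0 <= Num.sqrt M4 by exact: sqrtr_ge0.
  have x2 : 0 <= M3 / Num.sqrt b by rewrite divr_ge0 // ltW.
  have x3 : 0 <= 2 * M2 * L by rewrite !mulr_ge0.
  move: (r%:R / _) rb0 (Num.sqrt M4) x1 (M3 / _) x2 => q q0 y1 y10 y2 y20.
  have -> : 2 * M2 * q * L = 2 * M2 * L * q by ring.
  move: (2 * M2 * L) x3 => y3 y30; nra.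
move=> h; rewrite -(ler_pM2l k0) (le_trans h) //; rewrite le_eqVlt; apply/orP; left; apply/eqP.
have sm0 : 0 < Num.sqrt m by rewrite sqrtr_gt0.
by rewrite /kappa; field; rewrite !gt_eqF.
Qed.

(** * Stochastic orders *)

Section StochasticOrders.
Context {d : measure_display} {Omega : measurableType d} {R : realType}
  (P : probability Omega R).
Implicit Types (A B : set Omega) (U V : nat -> nat -> Omega -> R) (a : nat -> nat -> R).

(** Replaces the infimum in [outP] by an actual measurable cover, to which the union bound applies.
    Extracting a cover needs strictly more room than [e], hence the halvings below. *)
Definition covered (e : R) A : Prop :=
  exists2 B, measurable B /\ A `<=` B & (P B <= e%:E)%E.

Lemma outP_covered e A : covered e A -> (outP P A <= e%:E)%E.
Proof. by move=> [B mB PB]; apply: ge_ereal_inf; exists (P B) => //; exists B. Qed.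

Lemma covered_outP e e' A : e < e' -> (outP P A <= e%:E)%E -> covered e' A.
Proof.
move=> ee' hA; have : (outP P A < e'%:E)%E by rewrite (le_lt_trans hA) // lte_fin.
by move=> /ereal_inf_lt[_ [B [mB AB] <-] /ltW PB]; exists B.
Qed.

Lemma covered_sub e A A' : A' `<=` A -> covered e A -> covered e A'.
Proof. by move=> A'A [B [mB AB] PB]; exists B => //; split=> //; apply: subset_trans AB. Qed.

Lemma coveredU e e' A A' : covered e A -> covered e' A' -> covered (e + e') (A `|` A').
Proof.
move=> [B [mB AB] PB] [B' [mB' AB'] PB']; exists (B `|` B').
  by split; [exact: measurableU|exact: setUSS].
by apply: le_trans (measureU2 _ mB mB') _; rewrite EFinD leeD.
Qed.

Lemma OP_covered U a e : OP P U a -> 0 < e -> exists (M : R) (n0 : nat), 0 < M /\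
  forall N T, (n0 <= N)%N -> (n0 <= T)%N -> covered e [set w | M * a N T < `|U N T w|].
Proof.
move=> hU e0; have e2 : 0 < e / 2 by rewrite divr_gt0.
have [M [n0 [M0 h]]] := hU _ e2; exists M, n0; split=> // N T nN nT.
by apply: covered_outP (h N T nN nT); lra.
Qed.

Lemma wpa1_covered (E : nat -> nat -> set Omega) e : wpa1 P E -> 0 < e ->
  exists n0 : nat, forall N T, (n0 <= N)%N -> (n0 <= T)%N -> covered e (~` E N T).
Proof.
move=> hE e0; have e2 : 0 < e / 2 by rewrite divr_gt0.
have [n0 h] := hE _ e2; exists n0 => N T nN nT.
by apply: covered_outP (h N T nN nT); lra.
Qed.

Lemma OP_add U V a : OP P U a -> OP P V a -> (forall N T, 0 <= a N T) ->
  OP P (fun N T w => `|U N T w| + `|V N T w|) a.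
Proof.
move=> hU hV a0 e e0; have e2 : 0 < e / 2 by rewrite divr_gt0.
have [M [n [M0 h]]] := OP_covered _ _ _ hU e2.
have [M' [n' [M'0 h']]] := OP_covered _ _ _ hV e2.
exists (M + M'), (maxn n n'); split; first exact: addr_gt0.
move=> N T; rewrite !geq_max => /andP[nN n'N] /andP[nT n'T]; apply: outP_covered.
rewrite [e]splitr; apply: covered_sub (coveredU _ _ _ _ (h N T nN nT) (h' N T n'N n'T)).
move=> w /=; rewrite ger0_norm ?addr_ge0 // mulrDl => lt.
have [?|le1] := ltP (M * a N T) `|U N T w|; first by left.
by right; lra.
Qed.

(** Provides one constant and one threshold for all regressors together. *)
Lemma OP_sum (I : Type) (s : seq I) (U : I -> nat -> nat -> Omega -> R) a :
  (forall i, OP P (U i) a) -> (forall N T, 0 <= a N T) ->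
  OP P (fun N T w => \sum_(i <- s) `|U i N T w|) a.
Proof.
move=> hU a0; elim: s => [|i s IH].
  move=> e e0; exists 1, 0%N; split=> // N T _ _; apply: outP_covered.
  exists set0; last by rewrite measure0 lee_fin ltW.
  by split=> // w /=; rewrite big_nil normr0 ltNge mulr_ge0.
move=> e e0; have [M [n [M0 h]]] := OP_add _ _ _ (hU i) IH a0 e e0.
exists M, n; split=> // N T nN nT; move: (h N T nN nT).
congr (Order.le (outP P _) _); apply/seteqP; split=> w /=;
  by rewrite big_cons [`|\sum_(j <- s) _|]ger0_norm // sumr_ge0.
Qed.

(** The comparison must hold for every [M] with the same [C], since [M] depends on the tolerance
    [e]. *)
Lemma OP_dominated U V a a' (C : R) (n0 : nat) : 0 < C -> OP P U a ->
  (forall N T w M, (n0 <= N)%N -> (n0 <= T)%N -> 0 < M ->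
     `|U N T w| <= M * a N T -> `|V N T w| <= C * M * a' N T) ->
  OP P V a'.
Proof.
move=> C0 hU hUV e e0; have [M [n [M0 h]]] := OP_covered _ _ _ hU e0.
exists (C * M), (maxn n n0); split; first exact: mulr_gt0.
move=> N T; rewrite !geq_max => /andP[nN n'N] /andP[nT n'T]; apply: outP_covered.
apply: covered_sub (h N T nN nT) => w /=; rewrite !ltNge => /negP hV.
by apply/negP => hU'; apply: hV; apply: hUV.
Qed.

End StochasticOrders.

(** * Union bound over the stochastic conditions and choice of the number of factors *)

Theorem theorem1 (R : realType) (d : measure_display) (Omega : measurableType d)
  (P : probability Omega R) (K : nat)
  (X : forall N T : nat, Omega -> 'I_K -> 'M[R]_(N, T))
  (Gam eps : forall N T : nat, Omega -> 'M[R]_(N, T))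
  (beta0 : 'I_K -> R) (RNT : nat -> nat -> nat) (rho : R)
  (betahat : nat -> nat -> Omega -> 'I_K -> R) :
  (forall N T : nat, (0 < RNT N T)%N) ->
  (* betahat is the LS interactive fixed effects estimator with RNT factors,
     where Y_it = X_it' beta0 + Gam_it + eps_it *)
  (forall (N T : nat) (w : Omega),
     let Y := \matrix_(i < N, t < T)
                (\sum_(k < K) X N T w k i t * beta0 k + Gam N T w i t + eps N T w i t) in
     (exists b, is_LS (RNT N T) Y (X N T w) b) ->
     is_LS (RNT N T) Y (X N T w) (betahat N T w)) ->
  (* (1) *)
  (forall k : 'I_K, OP P (fun N T w => ((N * T)%:R)^-1 *
        \sum_(i < N) \sum_(t < T) (X N T w k i t) ^+ 2) (fun _ _ => 1)) ->
  OP P (fun N T w => specnorm (eps N T w)) (fun N T => Num.sqrt (maxn N T)%:R) ->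
  (* (2) *)
  (forall k : 'I_K, OP P (fun N T w =>
        \sum_(i < N) \sum_(t < T) X N T w k i t * eps N T w i t)
        (fun N T => Num.sqrt (N * T)%:R)) ->
  (* (3) *)
  (exists b : R, 0 < b /\
     wpa1 P (fun N T => [set w | forall delta : 'I_K -> R, enorm delta = 1 ->
        b <= \sum_((2 * RNT N T).+1 <= r < (minn N T).+1)
               sv ((Num.sqrt (N * T)%:R)^-1 *: \sum_(k < K) delta k *: X N T w k) r ^+ 2])) ->
  (* (4) *)
  3 / 2 < rho ->
  OP P (fun N T w => ((N * T)%:R)^-1 *
        \sum_((RNT N T).+1 <= r < (minn N T).+1) sv (Gam N T w) r ^+ 2)
     (fun N T => (RNT N T)%:R `^ (1 - 2 * rho)) ->
  (* R_NT = o(min(N,T)) *)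
  (forall e : R, 0 < e -> exists n0 : nat, forall N T : nat,
     (n0 <= N)%N -> (n0 <= T)%N -> (RNT N T)%:R <= e * (minn N T)%:R) ->
  (exists A B : nat -> nat -> Omega -> 'I_K -> R,
     (forall N T w k, betahat N T w k - beta0 k = A N T w k + B N T w k) /\
     OP P (fun N T w => enorm (A N T w)) (fun N T => (RNT N T)%:R `^ ((3 - 2 * rho) / 2)) /\
     OP P (fun N T w => enorm (B N T w))
        (fun N T => (RNT N T)%:R * (minn N T)%:R `^ (- (1 / 2)))) /\
  ((exists (c1 c2 : R) (n0 : nat), 0 < c1 /\ 0 < c2 /\
      forall N T : nat, (n0 <= N)%N -> (n0 <= T)%N ->
        c1 * (minn N T)%:R `^ (1 / (2 * rho - 1)) <= (RNT N T)%:R /\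
        (RNT N T)%:R <= c2 * (minn N T)%:R `^ (1 / (2 * rho - 1))) ->
   OP P (fun N T w => enorm (fun k => betahat N T w k - beta0 k))
      (fun N T => (minn N T)%:R `^ ((3 - 2 * rho) / (2 * (2 * rho - 1))))).
Proof.
move=> r_gt0 hLS h1 heps h2 [b [b0 h3]] hrho h4 _.
pose delta N T w k := betahat N T w k - beta0 k.
pose ra N T : R := (RNT N T)%:R `^ ((3 - 2 * rho) / 2).
pose rb N T : R := (RNT N T)%:R * (minn N T)%:R `^ (- (1 / 2)).
have ra0 N T : 0 <= ra N T by exact: powR_ge0.
have rb0 N T : 0 <= rb N T by rewrite mulr_ge0 ?powR_ge0.
have rate : OP P (fun N T w => enorm (delta N T w)) (fun N T => ra N T + rb N T).
  (* One fifth for each bad event: regressors, spectral norm, cross products, tail of [Gam], and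
     condition (3). *)
  move=> e e0; have e5 : 0 < e / 5 by rewrite divr_gt0.
  have [M1 [n1 [M10 c1]]] := OP_covered P _ _ _
    (OP_sum P _ (index_enum 'I_K) _ _ h1 (fun _ _ => ler01)) e5.
  have [M2 [n2 [M20 c2]]] := OP_covered P _ _ _ heps e5.
  have [M3 [n3 [M30 c3]]] := OP_covered P _ _ _
    (OP_sum P _ (index_enum 'I_K) _ _ h2 (fun _ _ => sqrtr_ge0 _)) e5.
  have [M4 [n4 [M40 c4]]] := OP_covered P _ _ _ h4 e5.
  have [n5 c5] := wpa1_covered P _ _ h3 e5.
  exists (4 / Num.sqrt b * (Num.sqrt M4 + M3 / Num.sqrt b
            + 2 * M2 * (1 + K%:R * Num.sqrt M1 / Num.sqrt b))).
  (* The 1 makes both dimensions positive. *)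
  exists (maxn 1 (maxn n1 (maxn n2 (maxn n3 (maxn n4 n5))))); split.
    have sb0 : 0 < Num.sqrt b by rewrite sqrtr_gt0.
    rewrite mulr_gt0 ?divr_gt0 // -addrA ltr_pwDl ?sqrtr_gt0 //.
    by rewrite addr_ge0 ?mulr_ge0 ?addr_ge0 ?divr_ge0 ?mulr_ge0 ?sqrtr_ge0 // ltW.
  move=> N T; rewrite !geq_max.
  move=> /andP[N0 /andP[N1 /andP[N2 /andP[N3 /andP[N4 N5]]]]].
  move=> /andP[T0 /andP[T1 /andP[T2 /andP[T3 /andP[T4 T5]]]]].
  apply: outP_covered.
  have -> : e = e / 5 + (e / 5 + (e / 5 + (e / 5 + e / 5))) by field.
  apply: covered_sub (coveredU P _ _ _ _ (c1 N T N1 T1) (coveredU P _ _ _ _ (c2 N T N2 T2)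
    (coveredU P _ _ _ _ (c3 N T N3 T3) (coveredU P _ _ _ _ (c4 N T N4 T4) (c5 N T N5 T5))))).
  move=> w bad; apply: contrapT => /not_orP[/negP + /not_orP[/negP + /not_orP[/negP +
    /not_orP[/negP + /contrapT g5]]]].
  rewrite -!leNgt mulr1 => g1 g2 g3 g4.
  move: bad => /=; apply/negP; rewrite -leNgt ger0_norm ?enorm_ge0 //.
  have YE : lincomb (X N T w) beta0 + Gam N T w + eps N T w
      = \matrix_(i, t) (\sum_(k < K) X N T w k i t * beta0 k + Gam N T w i t + eps N T w i t).
    apply/matrixP => i t; rewrite !mxE summxE; congr (_ + _ + _).
    by apply: eq_bigr => k _; rewrite mxE mulrC.
  apply: (is_LS_rate _ _ _ _ _ _ _ (X N T w) (Gam N T w) (eps N T w)) => //; try exact: ltW.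
  - move=> k; apply: le_trans g1; rewrite ger0_norm ?sumr_ge0 // (bigD1 k) //=.
    have -> : ip (X N T w k) (X N T w k) = \sum_(i < N) \sum_(t < T) X N T w k i t ^+ 2.
      by rewrite ipE; apply: eq_bigr => i _; apply: eq_bigr => t _; rewrite expr2.
    by rewrite (le_trans (ler_norm _)) // lerDl sumr_ge0.
  - exact: le_trans (ler_norm _) g2.
  - apply: le_trans g3; rewrite ger0_norm ?sumr_ge0 //; apply: ler_sum => k _.
    by rewrite ipC ipE.
  - exact: le_trans (ler_norm _) g4.
  - by rewrite YE; exact: hLS.
split.
  (* The whole error goes to the term with the larger rate. That rate is at least half of [ra + rb],
     hence the constant 2. *)
  exists (fun N T w k => if rb N T <= ra N T then delta N T w k else 0).
  exists (fun N T w k => if rb N T <= ra N T then 0 else delta N T w k).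
  have enorm0 : enorm (fun _ : 'I_K => 0 : R) = 0.
    by rewrite /enorm big1 ?sqrtr0 // => k _; rewrite expr0n.
  split; first by move=> N T w k; case: ifP => _; rewrite ?addr0 ?add0r.
  split; apply: (OP_dominated P _ _ _ _ 2 0 _ rate) => // N T w M _ _ M0 h.
    case: (boolP (rb N T <= ra N T)) => [ba|_]; last by rewrite enorm0 normr0 !mulr_ge0 // ltW.
    by apply: le_trans h _; rewrite -/(ra N T); nra.
  case: (boolP (rb N T <= ra N T)) => [_|]; first by rewrite enorm0 normr0 !mulr_ge0 // ?powR_ge0 // ltW.
  by rewrite -ltNge => ab; apply: le_trans h _; rewrite -/(rb N T); nra.
move=> [c1 [c2 [n0 [c10 [c20 hR]]]]].
have p0 : 2 * rho - 1 != 0 by rewrite gt_eqF //; lra.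
have s0 : (3 - 2 * rho) / 2 <= 0 by lra.
(* The exponent of [ra] is nonpositive, so [ra] is bounded through the lower bound [c1], and [rb]
   through [c2]. Both give the same power of the minimum, as
   $\frac1{2\rho-1}-\frac12=\frac{3-2\rho}{2(2\rho-1)}$. *)
apply: (OP_dominated P _ _ _ _ (c1 `^ ((3 - 2 * rho) / 2) + c2) (maxn 1 n0) _ rate).
  by rewrite ltr_wpDl ?powR_ge0.
move=> N T w M; rewrite !geq_max => /andP[N1 N0] /andP[T1 T0] M0 h.
apply: le_trans h _; have [hR1 hR2] := hR N T N0 T0.
have m0 : 0 < (minn N T)%:R :> R by rewrite ltr0n leq_min N1.
rewrite mulrAC -mulrA [M * _]mulrC mulrA ler_wpM2r ?(ltW M0) // mulrDl lerD //.
  have -> : (3 - 2 * rho) / (2 * (2 * rho - 1)) = 1 / (2 * rho - 1) * ((3 - 2 * rho) / 2).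
    by field.
  rewrite (powRrM (minn N T)%:R) -powRM ?powR_ge0 ?(ltW c10) //.
  by apply: le_powR_neg => //; rewrite mulr_gt0 ?powR_gt0.
have -> : (3 - 2 * rho) / (2 * (2 * rho - 1)) = 1 / (2 * rho - 1) + - (1 / 2) by field.
rewrite powRD; last by rewrite (gt_eqF m0) implybT.
by rewrite [leRHS]mulrA ler_wpM2r ?powR_ge0.
Qed.
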